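(* Let $\mu(x)=|x|^\alpha$ and $\mathbb{A}(x)=\mu(x)\,\mathbb{I}_n$ for $x\in\mathbb{R}^n$. There exists a constant $C(n)$, depending only on $n$, such that if $|\alpha|\le1$, then for every $R_0>0$ $$[\mathbb{A}]^2_{\mathrm{BMO}_{R_0}(B_1(0),\mu)}\le C(n)\,|\alpha|.$$
   Context: $\mathbb{I}_n$ is the $n\times n$ identity matrix, $B_r(x)\subset\mathbb{R}^n$ is the ball of radius $r$ centered at $x$, and $\mu(U)=\int_U\mu\,dx$. For $R_0>0$, an open set $U\subset\mathbb{R}^n$ and a locally integrable $f:\mathbb{R}^n\to\mathbb{R}$, $$[f]^2_{\mathrm{BMO}_{R_0}(U,\mu)}=\sup_{x\in U,\,0<\rho<R_0}\frac1{\mu(B_\rho(x))}\int_{B_\rho(x)}|f(y)-\langle f\rangle_{B_\rho(x)}|^2\mu^{-1}(y)\,dy,\qquad \langle f\rangle_B=\frac1{|B|}\int_Bf\,dx,$$ and for a matrix function $\mathbb{A}=(a_{ij})$, $[\mathbb{A}]^2_{\mathrm{BMO}_{R_0}(U,\mu)}=\sum_{i,j=1}^n[a_{ij}]^2_{\mathrm{BMO}_{R_0}(U,\mu)}$.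
   Formalization: The dimension is assumed to be n ≥ 2; for n = 1 the claim fails, since with α = 1 the oscillation over a ball centered at 0 is infinite, and as |α| → 1 no constant C(1) works. *)

(* Defs.v *)
From HB Require Import structures.
From mathcomp Require Import all_boot all_order all_algebra.
From mathcomp Require Import all_classical all_reals all_analysis.

Set Implicit Arguments.
Unset Strict Implicit.
Unset Printing Implicit Defensive.

Import Order.TTheory GRing.Theory Num.Theory.
Import numFieldNormedType.Exports.

Local Open Scope classical_set_scope.
Local Open Scope ring_scope.

(* R^n is n.-tuple R, with the library's product sigma-algebra. Its Lebesgue
   measure is built by recursion on n: the Dirac mass when n = 0, the image of
   a product measure under R * R^n -> R^n.+1 in the successor case. *)
Section lebesgue_measure_tuple.
Context (R : realType).
Local Open Scope ereal_scope.

Definition tcons n (p : R * n.-tuple R) : n.+1.-tuple R :=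
  [tuple of p.1 :: p.2].

Definition tuncons n (t : n.+1.-tuple R) : R * n.-tuple R :=
  (thead t, [tuple of behead t]).

Lemma tconsK n : cancel (@tcons n) (@tuncons n).
Proof.
by move=> [x t]; rewrite /tuncons theadE; congr pair; exact: val_inj.
Qed.

Lemma tunconsK n : cancel (@tuncons n) (@tcons n).
Proof. by move=> t; rewrite /tcons/= [RHS]tuple_eta. Qed.

Lemma measurable_tcons n : measurable_fun [set: R * n.-tuple R] (@tcons n).
Proof. exact: measurable_cons. Qed.

Lemma measurable_tuncons n : measurable_fun [set: n.+1.-tuple R] (@tuncons n).
Proof.
apply/measurable_fun_pairP; split; last exact: measurable_behead.
exact: measurable_tnth.
Qed.

Section step.
Variables (n : nat) (m : {sigma_finite_measure set (n.-tuple R) -> \bar R}).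

Definition lebesgue_tuple_step : set (n.+1.-tuple R) -> \bar R :=
  pushforward (@lebesgue_measure R \x m) (@tcons n).

Let step0 : lebesgue_tuple_step set0 = 0.
Proof. by rewrite /lebesgue_tuple_step /pushforward preimage_set0 measure0. Qed.

Let step_ge0 A : 0 <= lebesgue_tuple_step A.
Proof. exact: (measure_ge0 (@lebesgue_measure R \x m)). Qed.

Let step_sigma_additive : semi_sigma_additive lebesgue_tuple_step.
Proof.
move=> F mF tF mUF; rewrite /lebesgue_tuple_step /pushforward preimage_bigcup.
apply: measure_semi_sigma_additive.
- by move=> k; rewrite -[X in measurable X]setTI; exact: measurable_tcons.
- apply/trivIsetP => /= i j _ _ ij; rewrite -preimage_setI.
  by move/trivIsetP : tF => /(_ _ _ _ _ ij) ->//; rewrite preimage_set0.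
- rewrite -preimage_bigcup -[X in measurable X]setTI.
  exact: measurable_tcons.
Qed.

HB.instance Definition _ := isMeasure.Build _ _ _ lebesgue_tuple_step
  step0 step_ge0 step_sigma_additive.

Let step_sigma_finite : sigma_finite setT lebesgue_tuple_step.
Proof.
have /sigma_finiteP[F [TF ndF Foo]] := sigma_finiteT (@lebesgue_measure R).
have /sigma_finiteP[G [TG ndG Goo]] := sigma_finiteT m.
exists (fun k => @tuncons n @^-1` (F k `*` G k)) => [|k].
  apply/seteqP; split=> // t _.
  have [i _ Fi] : (\bigcup_k F k) (tuncons t).1 by rewrite -TF.
  have [j _ Gj] : (\bigcup_k G k) (tuncons t).2 by rewrite -TG.
  exists (maxn i j) => //; split.
  - by move: Fi; exact/subsetPset/ndF/leq_maxl.
  - by move: Gj; exact/subsetPset/ndG/leq_maxr.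
have [mF Fk] := Foo k; have [mG Gk] := Goo k; split.
  rewrite -[X in measurable X]setTI; apply: measurable_tuncons => //.
  exact: measurableX.
rewrite /lebesgue_tuple_step /pushforward -comp_preimage.
rewrite (_ : _ \o _ = id) ?preimage_id; last exact/funext/tconsK.
by rewrite product_measure1E// lte_mul_pinfty// ge0_fin_numE.
Qed.

HB.instance Definition _ := Measure_isSigmaFinite.Build _ _ _
  lebesgue_tuple_step step_sigma_finite.

End step.

Fixpoint lebesgue_tuple n : {sigma_finite_measure set (n.-tuple R) -> \bar R} :=
  if n is m.+1 then lebesgue_tuple_step (lebesgue_tuple m)
  else dirac (nil_tuple R).

Lemma lebesgue_tuple_box n (A : 'I_n -> set R) :
  (forall i, measurable (A i)) ->
  lebesgue_tuple n [set t | forall i, A i (tnth t i)] =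
  \prod_(i < n) lebesgue_measure (A i).
Proof.
elim: n A => [|n IH] A mA.
  rewrite big_ord0 /= diracE mem_set// => i; by case: i.
rewrite big_ord_recl -(IH (fun i => A (lift ord0 i)))//=.
rewrite /lebesgue_tuple_step /pushforward -product_measure1E//=.
- congr (product_measure1 _ _ _).
  apply/seteqP; split=> [[x t]/= H|[x t] [/= Hx Ht] i].
    split; first exact: (H ord0).
    by move=> i; have := H (lift ord0 i); rewrite tnthS.
  by have [j ->|->//] := unliftP ord0 i; rewrite tnthS; exact: Ht.
- exact: mA.
- rewrite (_ : mkset _ = \bigcap_(i in [set: 'I_n])
      ((fun t : n.-tuple R => tnth t i) @^-1` A (lift ord0 i))).
    apply: fin_bigcap_measurable => // i _.
    by rewrite -[X in measurable X]setTI; exact: measurable_tnth.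
  by apply/seteqP; split=> t /= H i; [move=> _|]; exact: H.
Qed.

End lebesgue_measure_tuple.

Section weighted_bmo.
Context (R : realType) (n : nat).
Implicit Types (x y : n.-tuple R) (U B : set (n.-tuple R)).
Implicit Types (mu f : n.-tuple R -> R) (A : n.-tuple R -> 'M[R]_n).

Local Notation leb := (lebesgue_tuple R n).

Definition origin : n.-tuple R := [tuple 0 | i < n].

Definition edist x y : R :=
  Num.sqrt (\sum_(i < n) (tnth x i - tnth y i) ^+ 2).

Definition enorm x : R := Num.sqrt (\sum_(i < n) tnth x i ^+ 2).

Definition eball x (r : R) : set (n.-tuple R) := [set y | edist x y < r].

Definition weight_measure mu U : \bar R := (\int[leb]_(x in U) (mu x)%:E)%E.

(* Meaningful when f is integrable on B and B has finite nonzero measure. *)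
Definition avg f B : R := (fine (leb B))^-1 * \int[leb]_(x in B) f x.

Definition bmo_osc mu f B : \bar R :=
  ((weight_measure mu B)^-1 *
   \int[leb]_(y in B) (`|f y - avg f B| ^+ 2 * (mu y)^-1)%:E)%E.

(* The squared seminorm, for locally integrable f; it may be +oo. *)
Definition bmo_sq (R0 : R) U mu f : \bar R :=
  ereal_sup [set v | exists x rho,
    [/\ U x, 0 < rho < R0 & v = bmo_osc mu f (eball x rho)]].

Definition bmo_sq_mx (R0 : R) U mu A : \bar R :=
  (\sum_(i < n) \sum_(j < n) bmo_sq R0 U mu (fun x => A x i j))%E.

(* For a != 0, powR takes the value 0 at the origin; when a < 0 this is a
   conventional value on a null set. *)
Definition power_weight (a : R) x : R := enorm x `^ a.

End weighted_bmo.

(* Main.v *)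
Require Import Defs.
From HB Require Import structures.
From mathcomp Require Import all_boot all_order all_algebra.
From mathcomp Require Import all_classical all_reals all_analysis.
From mathcomp Require Import measurable_realfun ring lra.

Import Order.TTheory GRing.Theory Num.Theory.
Import numFieldNormedType.Exports.

Local Open Scope classical_set_scope.
Local Open Scope ring_scope.

(* Write <f> for the average of f over a ball. Expanding the square, the
   weighted oscillation of w = |y|^a with respect to w itself equals
   <w><1/w> - 1, which is invariant under a -> -a. For 0 <= a <= 1 the tangent
   line bound t^a <= 1 - a + a t, applied to t = |y|/c and t = c/|y| with
   <|y|> <= c, gives <|y|^a><|y|^-a> <= 1 + a (K - 1) as soon as
   c <1/|y|> <= K: the factor |a| comes from interpolating between a = 0 and
   a = 1, and only the A_2 bound for the weight |y| remains.
   For a ball of radius r around x, if some |x_i| >= 2 r then |y| is comparable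
   to max |x_i| on the ball. Otherwise the ball lies in the cube |y_i| <= 3 r,
   where 1/|y| is integrated dyadically; this needs n >= 2. *)

(** * Weighted oscillation on an abstract measure space *)

Lemma powR_le_affine (R : realType) (a t : R) :
  0 <= a <= 1 -> 0 <= t -> t `^ a <= 1 - a + a * t.
Proof.
move=> /andP[a0 a1]; rewrite le_eqVlt => /predU1P[<-|t0].
  rewrite mulr0 addr0; have [->|an0] := eqVneq a 0.
    by rewrite powRr0 subr0.
  by rewrite powR0// subr_ge0.
set m := a * ln t.
have tE : t = expR m * expR (ln t - m) by rewrite -expRD addrC subrK lnK.
have -> : t `^ a = expR m by rewrite /powR gt_eqF.
have e1 := expR_ge1Dx (ln t - m); have e2 := expR_ge1Dx (- m).
have m_gt0 := expR_gt0 m.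
have emN : expR m * expR (- m) = 1 by rewrite -expRD subrr expR0.
(* Average [e1] and [e2] with weights a and 1 - a: the choice m = a ln t makes the linear terms
   cancel. *)
have key : 1 <= a * expR (ln t - m) + (1 - a) * expR (- m).
  have := ler_wpM2l a0 e1.
  have := @ler_wpM2l _ (1 - a) _ _ _ e2; rewrite subr_ge0 => /(_ a1).
  rewrite /m; lra.
have := ler_wpM2l (ltW m_gt0) key.
rewrite mulr1 => /le_trans; apply.
rewrite mulrDr mulrCA -tE mulrCA emN mulr1 addrC//.
Qed.

(** Transfers the tangent line bound to integrals. As both functions are nonnegative, measurability
    is enough to split the integral. *)
Lemma integral_affine_le d (T : measurableType d) (R : realType)
    (mu : {measure set T -> \bar R}) (D : set T) (b p q M : R) (f g : T -> R) :
  measurable D -> mu D = b%:E -> measurable_fun D f -> measurable_fun D g ->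
  (forall x, 0 <= f x) -> (forall x, 0 <= g x) -> 0 <= p -> 0 <= q ->
  (forall x, f x <= p + q * g x) ->
  (\int[mu]_(x in D) (g x)%:E <= M%:E)%E ->
  (\int[mu]_(x in D) (f x)%:E <= (p * b + q * M)%:E)%E.
Proof.
move=> mD Db mf mg f0 g0 p0 q0 fg gM.
apply: (@le_trans _ _ (\int[mu]_(x in D) (p%:E + q%:E * (g x)%:E))%E).
  apply: ge0_le_integral => //.
  - by move=> x _; rewrite lee_fin.
  - exact/measurable_EFinP.
  - apply: (@eq_measurable_fun _ _ _ _ _ (EFin \o (fun x => p + q * g x))).
      by [].
    apply/measurable_EFinP/measurable_funD => //.
    exact: measurable_funM.
  - by move=> x _; rewrite -EFinM -EFinD lee_fin.
have mg' : measurable_fun D (EFin \o g) by exact/measurable_EFinP.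
rewrite ge0_integralD//=.
- rewrite integral_cst// Db -EFinM EFinD leeD2l//.
  rewrite ge0_integralZl_EFin//= ?EFinM ?lee_wpmul2l ?lee_fin//.
  by move=> x _; rewrite lee_fin.
- by move=> x _; rewrite -EFinM lee_fin mulr_ge0.
- apply/measurable_EFinP; exact: measurable_funM.
Qed.

Lemma measurable_funVr d (T : measurableType d) (R : realType) (D : set T)
    (f : T -> R) : (forall x, 0 <= f x) ->
  measurable_fun D f -> measurable_fun D (fun x => (f x)^-1).
Proof.
(* On nonnegative reals inversion is the power -1, also at 0, where both give 0. *)
move=> f0 mf; have -> : (fun x => (f x)^-1) = (@powR R ^~ (-1)) \o f.
  by apply/funext => x /=; rewrite powR_inv1.
exact: (measurableT_comp (measurable_powR (-1))).
Qed.

(** Where w is nonzero, (w - m)^2 / w = w - 2 m + m^2 / w, and the zero set of w is null. *)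
Lemma integral_sqr_dev d (T : measurableType d) (R : realType)
    (mu : {measure set T -> \bar R}) (D : set T) (w : T -> R) (b W V m : R) :
  measurable D -> mu D = b%:E -> measurable_fun setT w ->
  (forall x, 0 <= w x) -> mu (w @^-1` [set 0]) = 0%E -> 0 <= m ->
  (\int[mu]_(x in D) (w x)%:E = W%:E)%E ->
  (\int[mu]_(x in D) ((w x)^-1)%:E = V%:E)%E ->
  (\int[mu]_(x in D) (`|w x - m| ^+ 2 * (w x)^-1)%:E =
     (W - 2 * m * b + m ^+ 2 * V)%:E)%E.
Proof.
move=> mD Db mw w0 N0 m0 wW wV.
have mwD : measurable_fun D w by exact: measurable_funTS.
have mwV : measurable_fun D (fun x => (w x)^-1) by exact: measurable_funVr.
have mosc : measurable_fun D (fun x => `|w x - m| ^+ 2 * (w x)^-1).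
  apply: measurable_funM => //; apply: measurable_funX.
  apply: (measurableT_comp (@normr_measurable R setT)).
  exact: measurable_funB.
have osc0 x : 0 <= `|w x - m| ^+ 2 * (w x)^-1 by rewrite mulr_ge0 ?invr_ge0.
(* Both integrands below are nonnegative, so all integrals split; the
   pointwise identity fails only where w vanishes, because 0^-1 = 0. *)
have eq_int : (\int[mu]_(x in D) ((`|w x - m| ^+ 2 * (w x)^-1)%:E + (2 * m)%:E)
   = \int[mu]_(x in D) ((w x)%:E + (m ^+ 2)%:E * ((w x)^-1)%:E))%E.
  apply: ge0_ae_eq_integral => //.
  - by apply: emeasurable_funD => //; exact/measurable_EFinP.
  - apply: emeasurable_funD; first exact/measurable_EFinP.
    by apply: emeasurable_funM => //; exact/measurable_EFinP.
  - by move=> x _; rewrite -EFinD lee_fin addr_ge0// mulr_ge0.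
  - move=> x _; rewrite -EFinM -EFinD lee_fin.
    by rewrite addr_ge0// mulr_ge0 ?invr_ge0 ?sqr_ge0.
  - exists (w @^-1` [set 0]); split => //.
      by rewrite -[X in measurable X]setTI; exact: mw.
    move=> x /= /not_implyP[_ H]; apply: contrapT => wx0; apply: H.
    have {}wx0 : w x != 0 by exact/eqP.
    rewrite -EFinM -!EFinD; congr (_%:E).
    rewrite real_normK ?num_real//.
    by field.
have intL : (\int[mu]_(x in D)
    ((`|w x - m| ^+ 2 * (w x)^-1)%:E + (2 * m)%:E) =
    \int[mu]_(x in D) (`|w x - m| ^+ 2 * (w x)^-1)%:E + (2 * m * b)%:E)%E.
  rewrite ge0_integralD//=; first by rewrite integral_cst// Db -EFinM.
  - by move=> x _; rewrite lee_fin.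
  - exact/measurable_EFinP.
  - by move=> x _; rewrite lee_fin mulr_ge0.
have intR : (\int[mu]_(x in D) ((w x)%:E + (m ^+ 2)%:E * ((w x)^-1)%:E) =
    (W + m ^+ 2 * V)%:E)%E.
  rewrite ge0_integralD//=.
  - rewrite wW ge0_integralZl_EFin//= ?wV ?sqr_ge0//.
    + by move=> x _; rewrite lee_fin invr_ge0.
    + exact/measurable_EFinP.
  - by move=> x _; rewrite lee_fin.
  - exact/measurable_EFinP.
  - by move=> x _; rewrite -EFinM lee_fin mulr_ge0 ?invr_ge0 ?sqr_ge0.
  - by apply: emeasurable_funM => //; exact/measurable_EFinP.
move: eq_int; rewrite intL intR.
(* The integral sought is still an extended real; the finite right-hand side rules out infinite
   values. *)
case: (integral _ _ _) => [r| |]//= [] H.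
congr (_%:E); lra.
Qed.

(** Let W and V be the integrals of w and 1/w. At m = W / b the expansion becomes W^2 V / b^2 - W;
    dividing by W leaves the product of the two means, minus 1. *)
Lemma osc_le d (T : measurableType d) (R : realType)
    (mu : {measure set T -> \bar R}) (D : set T) (w : T -> R) (b P Q : R) :
  measurable D -> mu D = b%:E -> 0 < b -> measurable_fun setT w ->
  (forall x, 0 <= w x) -> mu (w @^-1` [set 0]) = 0%E ->
  (\int[mu]_(x in D) (w x)%:E <= (P * b)%:E)%E ->
  (\int[mu]_(x in D) ((w x)^-1)%:E <= (Q * b)%:E)%E ->
  ((\int[mu]_(x in D) (w x)%:E)^-1 *
    \int[mu]_(x in D) (`|w x - b^-1 * fine (\int[mu]_(x in D) (w x)%:E)| ^+ 2 *
      (w x)^-1)%:E <= (P * Q - 1)%:E)%E.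
Proof.
move=> mD Db b0 mw w0 N0 wP wQ.
have W0 : (0 <= \int[mu]_(x in D) (w x)%:E)%E.
  by apply: integral_ge0 => x _; rewrite lee_fin.
have V0 : (0 <= \int[mu]_(x in D) ((w x)^-1)%:E)%E.
  by apply: integral_ge0 => x _; rewrite lee_fin invr_ge0.
case wW : (\int[mu]_(x in D) (w x)%:E)%E W0 wP => [W| |]//.
rewrite !lee_fin => W0 WP.
case wV : (\int[mu]_(x in D) ((w x)^-1)%:E)%E V0 wQ => [V| |]//.
rewrite !lee_fin => V0 VQ.
have dev m : 0 <= m -> (\int[mu]_(x in D) (`|w x - m| ^+ 2 * (w x)^-1)%:E =
     (W - 2 * m * b + m ^+ 2 * V)%:E)%E by move=> ?; exact: integral_sqr_dev.
(* W > 0 is needed as 0^-1 = +oo in \bar R; otherwise the nonnegative integral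
   [dev] would be negative at m = b / (V + 1). *)
have {}W0 : 0 < W.
  have V1 : 0 < V + 1 by lra.
  have m0 : 0 < b / (V + 1) by rewrite divr_gt0.
  have : (0 <= (W - 2 * (b / (V + 1)) * b + (b / (V + 1)) ^+ 2 * V)%:E)%E.
    rewrite -(dev _ (ltW m0)); apply: integral_ge0 => x _.
    by rewrite lee_fin mulr_ge0 ?invr_ge0.
  rewrite lee_fin; set m := b / (V + 1) in m0 *.
  have -> : b = m * (V + 1) by rewrite /m divfK// gt_eqF.
  have : 0 < m ^+ 2 by rewrite exprn_gt0.
  have : 0 <= m ^+ 2 * V by rewrite mulr_ge0// sqr_ge0.
  lra.
rewrite /= dev; last by rewrite mulr_ge0 ?invr_ge0 ?ltW.
rewrite inver gt_eqF// -EFinM lee_fin.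
have -> : W^-1 * (W - 2 * (b^-1 * W) * b + (b^-1 * W) ^+ 2 * V) =
    (W / b) * (V / b) - 1.
  by field; rewrite !gt_eqF.
by rewrite lerB// ler_pM ?divr_ge0 ?ler_pdivrMr// ltW.
Qed.

(** [c] and [K] encode an A_2 bound for [u]. The powers of c cancel in the product of the means of w
    and 1/w, which is thus at most 1 + |a| (K - 1). *)
Lemma power_osc_le d (T : measurableType d) (R : realType)
    (mu : {measure set T -> \bar R}) (D : set T) (u w : T -> R)
    (b c K a : R) :
  measurable D -> mu D = b%:E -> 0 < b -> measurable_fun setT u ->
  (forall x, 0 <= u x) -> mu (u @^-1` [set 0]) = 0%E -> 0 < c -> 0 <= K ->
  (\int[mu]_(x in D) (u x)%:E <= (c * b)%:E)%E ->
  (\int[mu]_(x in D) ((u x)^-1)%:E <= (K / c * b)%:E)%E ->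
  `|a| <= 1 -> w = (fun x => u x `^ a) ->
  ((\int[mu]_(x in D) (w x)%:E)^-1 *
    \int[mu]_(x in D) (`|w x - b^-1 * fine (\int[mu]_(x in D) (w x)%:E)| ^+ 2 *
      (w x)^-1)%:E <= (K * `|a|)%:E)%E.
Proof.
move=> mD Db b0 mu' u0 N0 c0 K0 uc uK a1 wE.
have mp e : measurable_fun setT (fun x => u x `^ e).
  exact: (measurableT_comp (measurable_powR e)).
have w0 x : 0 <= w x by rewrite wE powR_ge0.
have mw : measurable_fun setT w by rewrite wE; exact: mp.
have wN0 : mu (w @^-1` [set 0]) = 0%E.
  apply: (@subset_measure0 _ _ _ mu _ (u @^-1` [set 0])) => //.
  - by rewrite -[X in measurable X]setTI; exact: mw.
  - by rewrite -[X in measurable X]setTI; exact: mu'.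
  - by move=> x /= /eqP; rewrite wE powR_eq0 => /andP[/eqP].
have pow e : 0 <= e <= 1 ->
  (\int[mu]_(x in D) (u x `^ e)%:E <= (c `^ e * b)%:E)%E /\
  (\int[mu]_(x in D) ((u x `^ e)^-1)%:E <=
     ((c `^ e)^-1 * (1 - e + e * K) * b)%:E)%E.
  move=> e01; have [e0 e1] := andP e01.
  have ce0 := powR_gt0 e c0.
  split.
    (* The tangent line bound at t = u / c, multiplied by c^e; since the mean of u is at most c, the
       coefficients 1 - e and e add up to 1. *)
    have := @integral_affine_le _ _ _ mu D b (c `^ e * (1 - e))
      (c `^ e * e / c) (c * b) (fun x => u x `^ e) u mD Db.
    rewrite (_ : _ * b + _ = c `^ e * b); last by field; rewrite gt_eqF.
    apply => //; try by [exact: measurable_funTS | move=> ?; exact: powR_ge0].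
    - by rewrite mulr_ge0 ?subr_ge0// ltW.
    - by rewrite !mulr_ge0 ?invr_ge0// ltW.
    - move=> x; have uc0 := divr_ge0 (u0 x) (ltW c0).
      have := ler_wpM2l (ltW ce0) (powR_le_affine _ _ _ e01 uc0).
      rewrite -powRM// ?(ltW c0)// mulrCA divff ?gt_eqF// mulr1.
      by rewrite mulrDr !mulrA (mulrAC _ (u x)).
  (* The same at t = c / u. Where u = 0 the convention 0^-1 = 0 gives t = 0, which the bound
     admits. *)
  have := @integral_affine_le _ _ _ mu D b ((c `^ e)^-1 * (1 - e))
      ((c `^ e)^-1 * e * c) (K / c * b)
      (fun x => (u x `^ e)^-1) (fun x => (u x)^-1) mD Db.
  rewrite (_ : _ * b + _ = (c `^ e)^-1 * (1 - e + e * K) * b); last first.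
    by field; rewrite !gt_eqF.
  apply => //; try by move=> ?; rewrite ?invr_ge0 ?powR_ge0.
  - apply: measurable_funVr; [by move=> ?; exact: powR_ge0|].
    exact: measurable_funTS.
  - apply: measurable_funVr => //; exact: measurable_funTS.
  - by rewrite mulr_ge0 ?invr_ge0 ?subr_ge0// ltW.
  - by rewrite !mulr_ge0 ?invr_ge0// ltW.
  - move=> x; have cu0 := divr_ge0 (ltW c0) (u0 x).
    have ce0' : 0 <= (c `^ e)^-1 by rewrite invr_ge0 ltW.
    have := ler_wpM2l ce0' (powR_le_affine _ _ _ e01 cu0).
    rewrite powRM ?invr_ge0 ?(ltW c0)// mulKf ?gt_eqF//.
    rewrite -(powR_inv1 (u0 x)) -powRrM mulN1r powRN => /le_trans; apply.
    by rewrite powR_inv1// mulrDr !mulrA.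
have [a0|a0] := leP 0 a.
  have a01 : 0 <= a <= 1 by move: a1; rewrite ger0_norm// a0.
  have [H1 H2] := pow _ a01.
  apply: le_trans (osc_le _ _ _ _ _ _ _ _ _ mD Db b0 mw w0 wN0 _ _) _.
  - by rewrite wE; exact: H1.
  - by rewrite wE; exact: H2.
  rewrite lee_fin ger0_norm// mulrA divff ?gt_eqF ?powR_gt0// mul1r; lra.
(* For negative a, w is the inverse of u^(-a), so the two estimates of [pow] trade places. *)
have a01 : 0 <= - a <= 1 by move: a1; rewrite ltr0_norm// oppr_ge0 (ltW a0).
have [H1 H2] := pow _ a01.
have {}wE x : w x = (u x `^ (- a))^-1 by rewrite wE -powRN opprK.
apply: le_trans (osc_le _ _ _ _ _ _ _ _ _ mD Db b0 mw w0 wN0 _ _) _.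
- by under eq_integral do rewrite wE; exact: H2.
- by under eq_integral do rewrite wE invrK; exact: H1.
rewrite lee_fin ltr0_norm// mulrAC mulVf ?gt_eqF ?powR_gt0// mul1r.
lra.
Qed.

(** * Cubes and balls in R^n *)

Lemma le_sqrt_sum (R : realType) (n : nat) (v : 'I_n -> R) (i : 'I_n) :
  `|v i| <= Num.sqrt (\sum_(j < n) v j ^+ 2).
Proof.
rewrite -sqrtr_sqr ler_wsqrtr// (bigD1 i)//= lerDl sumr_ge0// => j _.
exact: sqr_ge0.
Qed.

Lemma sum_sqr_le (R : realType) (n : nat) (v : 'I_n -> R) (M : R) :
  (forall i, `|v i| <= M) -> \sum_(j < n) v j ^+ 2 <= n%:R * M ^+ 2.
Proof.
move=> vM; apply: le_trans (_ : _ <= \sum_(j < n) M ^+ 2) _.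
  apply: ler_sum => i _; rewrite -real_normK ?num_real// ler_sqr ?nnegrE//.
  exact: le_trans (vM i).
by rewrite sumr_const card_ord mulr_natl.
Qed.

(** The sharp factor sqrt n is relaxed to n, which keeps roots out of the constants. *)
Lemma sqrt_sum_le (R : realType) (n : nat) (v : 'I_n -> R) (M : R) :
  0 <= M -> (forall i, `|v i| <= M) ->
  Num.sqrt (\sum_(j < n) v j ^+ 2) <= n%:R * M.
Proof.
move=> M0 vM; have nM0 : 0 <= n%:R * M by rewrite mulr_ge0.
rewrite -(ger0_norm nM0) -sqrtr_sqr ler_wsqrtr//.
apply: le_trans (sum_sqr_le _ _ _ _ vM) _.
rewrite exprMn ler_wpM2r ?sqr_ge0// -natrX ler_nat.
by case: n {vM v nM0} => // n; rewrite leq_pmulr.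
Qed.

(** Comparison sets for balls, with explicit measure. Being closed, the cube of half-side 0 is a
    point and not empty. *)
Definition cube {R : realType} {n : nat} (x : n.-tuple R) (r : R)
    : set (n.-tuple R) :=
  [set y | forall i, `|tnth x i - tnth y i| <= r].

Lemma cubeE (R : realType) (n : nat) (x : n.-tuple R) (r : R) :
  cube x r =
  [set y | forall i, `[tnth x i - r, tnth x i + r]%classic (tnth y i)].
Proof.
by apply/seteqP; split=> y /= H i; have := H i; rewrite /= in_itv /= ler_distlC.
Qed.

Lemma measurable_cube (R : realType) (n : nat) (x : n.-tuple R) (r : R) :
  measurable (cube x r).
Proof.
rewrite cubeE (_ : mkset _ = \bigcap_(i in [set: 'I_n])
    ((fun t : n.-tuple R => tnth t i) @^-1` `[tnth x i - r, tnth x i + r])).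
  apply: fin_bigcap_measurable => // i _.
  by rewrite -[X in measurable X]setTI; exact: measurable_tnth.
by apply/seteqP; split=> t /= H i; [move=> _|]; exact: H.
Qed.

Lemma lebesgue_cube (R : realType) (n : nat) (x : n.-tuple R) (r : R) :
  0 <= r -> lebesgue_tuple R n (cube x r) = ((2 * r) ^+ n)%:E.
Proof.
move=> r0; rewrite cubeE (@lebesgue_tuple_box R n (fun i =>
  `[tnth x i - r, tnth x i + r]%classic))//.
have -> : (2 * r) ^+ n = \prod_(i < n) (2 * r).
  by rewrite prodr_const card_ord.
rewrite (big_morph EFin (@EFinM R) erefl); apply: eq_bigr => i _.
rewrite lebesgue_measure_itv/= lte_fin.
have -> : (tnth x i - r < tnth x i + r) = (0 < r) by apply/idP/idP; lra.
case: ltP => r'; first by rewrite -EFinB; congr (_%:E); ring.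
by rewrite (_ : r = 0) ?mulr0//; apply/le_anti; rewrite r0 r'.
Qed.

Lemma measurable_enorm (R : realType) (n : nat) :
  measurable_fun setT (@enorm R n).
Proof.
have -> : @enorm R n =
    (@powR R ^~ 2^-1) \o (fun x => \sum_(i < n) tnth x i ^+ 2).
  apply/funext => x /=; rewrite powR12_sqrt// sumr_ge0// => i _.
  exact: sqr_ge0.
apply: measurableT_comp; first exact: measurable_powR.
apply: measurable_sum => i; apply: measurable_funX; exact: measurable_tnth.
Qed.

Lemma measurable_eball (R : realType) (n : nat) (x : n.-tuple R) (r : R) :
  measurable (eball x r).
Proof.
have -> : eball x r = (fun y => Defs.edist x y) @^-1` `]-oo, r[.
  by apply/seteqP; split => y /=; rewrite in_itv.
rewrite -[X in measurable X]setTI.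
suff mf : measurable_fun setT (fun y => Defs.edist x y) by exact: mf.
have -> : (fun y => Defs.edist x y) =
    (@powR R ^~ 2^-1) \o (fun y => \sum_(i < n) (tnth x i - tnth y i) ^+ 2).
  apply/funext => y /=; rewrite powR12_sqrt// sumr_ge0// => i _.
  exact: sqr_ge0.
apply: measurableT_comp; first exact: measurable_powR.
apply: measurable_sum => i; apply: measurable_funX.
apply: measurable_funB => //; exact: measurable_tnth.
Qed.

Lemma eball_sub_cube (R : realType) (n : nat) (x : n.-tuple R) (r : R) :
  eball x r `<=` cube x r.
Proof.
move=> y /= xy i; apply: le_trans (ltW xy).
exact: (le_sqrt_sum _ _ (fun i => tnth x i - tnth y i)).
Qed.

(** The squared distance is at most n (r / n)^2 = r^2 / n, strictly below r^2 because n > 1. *)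
Lemma cube_sub_eball (R : realType) (n : nat) (x : n.-tuple R) (r : R) :
  (1 < n)%N -> 0 < r -> cube x (r / n%:R) `<=` eball x r.
Proof.
move=> n1 r0 y xy; rewrite /eball/= /Defs.edist.
have n1R : 1 < n%:R :> R by rewrite ltr1n.
have n0 : 0 < n%:R :> R by rewrite (lt_trans ltr01).
rewrite -[ltRHS](ger0_norm (ltW r0)) -sqrtr_sqr ltr_sqrt ?exprn_gt0//.
apply: le_lt_trans (sum_sqr_le _ _ _ _ xy) _.
rewrite (_ : _ * _ = r ^+ 2 / n%:R); last by field; rewrite gt_eqF.
by rewrite ltr_pdivrMr// ltr_pMr// exprn_gt0.
Qed.

(** The zero set lies in a cube of half-side 0, of measure 0^n; for n = 0 this would be 1. *)
Lemma lebesgue_enorm_eq0 (R : realType) (n : nat) :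
  (0 < n)%N -> lebesgue_tuple R n (@enorm R n @^-1` [set 0]) = 0%E.
Proof.
move=> n0; apply: (@subset_measure0 _ _ _ (lebesgue_tuple R n) _
    (cube (origin R n) 0)).
- by rewrite -[X in measurable X]setTI; exact: measurable_enorm.
- exact: measurable_cube.
- move=> y /= y0 i; rewrite tnth_mktuple sub0r normrN -y0.
  exact: (le_sqrt_sum _ _ (fun i => tnth y i)).
- by rewrite [LHS]lebesgue_cube// mulr0 expr0n gtn_eqF.
Qed.

(** * Dyadic integration of 1/|y| over a cube *)

(** If k is the last index whose cube contains y, some coordinate exceeds s / 2^(k+1), so the k-th
    term alone dominates 1/|y|. At the origin 1/|y| is 0 by convention. *)
Lemma enorm_inv_le_series (R : realType) (n : nat) (s : R) (y : n.-tuple R) :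
  0 < s -> cube (origin R n) s y ->
  (((enorm y)^-1)%:E <= \sum_(k <oo)
    (2 ^+ k.+1 / s * \1_(cube (origin R n) (s / 2 ^+ k)) y)%:E)%E.
Proof.
move=> s0 ys; have c0 (k : nat) :
    0 <= 2 ^+ k.+1 / s * \1_(cube (origin R n) (s / 2 ^+ k)) y.
  by rewrite mulr_ge0// divr_ge0// ltW.
have [y0|/eqP y0] := pselect (enorm y = 0).
  by rewrite y0 invr0; apply: nneseries_ge0 => k _ _; rewrite lee_fin.
have ey0 : 0 < enorm y by rewrite lt_neqAle eq_sym y0 sqrtr_ge0.
have exN : exists N, ~~ `[< cube (origin R n) (s / 2 ^+ N) y >].
  have [i yi0] : exists i, tnth y i != 0.
    apply: contrapT => /forallNP H; move/eqP: y0; apply.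
    rewrite /enorm big1 ?sqrtr0// => i _.
    by have /negP/negPn/eqP -> := H i; rewrite expr0n.
  have yi : 0 < `|tnth y i| by rewrite normr_gt0.
  have [N HN] : exists N, s / `|tnth y i| < 2 ^+ N.
    exists (Num.Def.archi_bound (s / `|tnth y i|)).
    apply: lt_trans (archi_boundP _) _; first by rewrite divr_ge0// ltW.
    by rewrite -natrX ltr_nat ltn_expl.
  exists N; apply/asboolPn => /(_ i).
  rewrite tnth_mktuple sub0r normrN leNgt ltr_pdivrMr ?exprn_gt0//.
  by rewrite mulrC -ltr_pdivrMr// HN.
(* The least index whose cube misses y is not 0, since y lies in the initial cube; its predecessor
   is the k sought. *)
case: (ex_minnP exN) => -[|k] /asboolPn yk kmin.
  by exfalso; apply: yk; rewrite expr0 divr1.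
have {}kmin : cube (origin R n) (s / 2 ^+ k) y.
  by apply: contrapT => /asboolPn /kmin; rewrite ltnn.
apply: (@le_trans _ _ (2 ^+ k.+1 / s * \1_(cube (origin R n) (s / 2 ^+ k)) y)%:E).
  rewrite indicE mem_set// mulr1 lee_fin -[leRHS]invf_div lef_pV2 ?posrE//; last first.
    by rewrite divr_gt0// exprn_gt0.
  move/existsNP : yk => [i /negP]; rewrite -ltNge tnth_mktuple sub0r normrN.
  move/ltW/le_trans; apply; exact: (le_sqrt_sum _ _ (fun i => tnth y i)).
apply: le_trans (nneseries_lim_ge k.+1 _); last first.
  by move=> j _ _; rewrite lee_fin.
rewrite big_nat_recr//= leeDr// sume_ge0// => j _.
by rewrite lee_fin.
Qed.

(** The k-th term integrates to at most 2^(k+1) / s * (2 s / 2^k)^n, which decays at least like 2^-k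
    because n >= 2. *)
Lemma integral_enorm_inv_cube (R : realType) (n : nat) (s : R) :
  (1 < n)%N -> 0 < s ->
  (\int[lebesgue_tuple R n]_(y in cube (origin R n) s) ((enorm y)^-1)%:E <=
    (4 / s * (2 * s) ^+ n)%:E)%E.
Proof.
move=> n1 s0; set D := cube _ _; set mu := lebesgue_tuple R n.
have mD : measurable D by exact: measurable_cube.
have mf k : measurable_fun D (fun y =>
    (2 ^+ k.+1 / s * \1_(cube (origin R n) (s / 2 ^+ k)) y)%:E).
  apply/measurable_EFinP; apply: measurable_funM => //.
  by apply: measurable_indic; exact: measurable_cube.
have f0 k y : (0 <= (2 ^+ k.+1 / s *
    \1_(cube (origin R n) (s / 2 ^+ k)) y)%:E)%E.
  by rewrite lee_fin mulr_ge0// divr_ge0// ltW.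
apply: (@le_trans _ _ (\int[mu]_(y in D) \sum_(k <oo)
    (2 ^+ k.+1 / s * \1_(cube (origin R n) (s / 2 ^+ k)) y)%:E)%E).
  apply: ge0_le_integral => //.
  - by move=> y _; rewrite lee_fin invr_ge0 sqrtr_ge0.
  - apply/measurable_EFinP/measurable_funVr; last first.
      by apply: measurable_funTS; exact: measurable_enorm.
    by move=> y; exact: sqrtr_ge0.
  - by apply: ge0_emeasurable_sum => // k y _ _; exact: f0.
  - by move=> y yD; exact: enorm_inv_le_series.
rewrite integral_nneseries//.
(* It suffices to bound the k-th term by the claimed total divided by 2^(k+1). *)
apply: le_trans (epsilon_trick0 xpredT _); last first.
  by rewrite mulr_ge0 ?divr_ge0 ?exprn_ge0 ?mulr_ge0// ltW.
apply: lee_nneseries => [k _ _|k _].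
  by apply: integral_ge0 => y _; exact: f0.
under eq_integral do rewrite EFinM.
rewrite ge0_integralZl_EFin//=; last 2 first.
- apply/measurable_EFinP; apply: measurable_indic; exact: measurable_cube.
- by rewrite divr_ge0// ltW.
rewrite integral_indic//; last exact: measurable_cube.
apply: (@le_trans _ _ ((2 ^+ k.+1 / s)%:E * ((2 * (s / 2 ^+ k)) ^+ n)%:E)%E).
  apply: lee_wpmul2l; first by rewrite lee_fin divr_ge0// ltW.
  rewrite -(lebesgue_cube R n (origin R n)); last by rewrite divr_ge0// ltW.
  apply: le_measure; rewrite ?inE; [|exact: measurable_cube|exact: subIsetl].
  by apply: measurableI => //; exact: measurable_cube.
rewrite -EFinM lee_fin.
(* With dimension n + 2 and t = 2^k, the term is the geometric bound divided by t^n >= 1. *)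
case: n n1 {mu D mD mf f0} => [|[|n]]// _.
rewrite natrX; set t := 2 ^+ k; have t1 : 1 <= t :> R by rewrite exprn_ege1// ler1n.
have t0 : 0 < t by lra.
rewrite exprS -/t mulrA expr_div_n.
rewrite [leLHS](_ : _ = 4 / s * (2 * s) ^+ n.+2 / (2 * t) * (t ^+ n)^-1).
  have tn1 : 1 <= t ^+ n := exprn_ege1 n t1.
  rewrite ler_piMr ?invf_le1 ?(lt_le_trans ltr01)//.
  have s2 : 0 <= 2 * s by lra.
  apply: divr_ge0; last by lra.
  by apply: mulr_ge0; [rewrite divr_ge0// ltW|exact: exprn_ge0].
rewrite !exprS; field.
by rewrite !gt_eqF ?exprn_gt0.
Qed.

(** * The A_2 bound for |y| on balls *)

(** The circumscribed cube gives finiteness, the inscribed one the lower bound. *)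
Lemma lebesgue_eball (R : realType) (n : nat) (x : n.-tuple R) (r : R) :
  (1 < n)%N -> 0 < r -> exists2 b,
    lebesgue_tuple R n (eball x r) = b%:E & (2 * (r / n%:R)) ^+ n <= b.
Proof.
move=> n1 r0; set mu := lebesgue_tuple R n.
have mB := measurable_eball R n x r.
have ub : (mu (eball x r) <= ((2 * r) ^+ n)%:E)%E.
  rewrite -(lebesgue_cube R n x); last exact: ltW.
  apply: le_measure; rewrite ?inE//; first exact: measurable_cube.
  exact: eball_sub_cube.
have lb : (((2 * (r / n%:R)) ^+ n)%:E <= mu (eball x r))%E.
  rewrite -(lebesgue_cube R n x); last by rewrite divr_ge0// ltW.
  apply: le_measure; rewrite ?inE//; first exact: measurable_cube.
  exact: cube_sub_eball.
case: (mu (eball x r)) ub lb => [b| |]// _ lb.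
by exists b.
Qed.

Lemma integral_le_cst d (T : measurableType d) (R : realType)
    (mu : {measure set T -> \bar R}) (D : set T) (b M : R) (f : T -> R) :
  measurable D -> mu D = b%:E -> measurable_fun D f ->
  (forall x, 0 <= f x) -> (forall x, D x -> f x <= M) ->
  (\int[mu]_(x in D) (f x)%:E <= (M * b)%:E)%E.
Proof.
move=> mD Db mf f0 fM; rewrite EFinM -Db -integral_cst//.
apply: ge0_le_integral => //.
- by move=> x _; rewrite lee_fin.
- exact/measurable_EFinP.
Qed.

Lemma enorm_A2 (R : realType) (n : nat) (x : n.-tuple R) (r b : R) :
  (1 < n)%N -> 0 < r -> lebesgue_tuple R n (eball x r) = b%:E ->
  (2 * (r / n%:R)) ^+ n <= b -> exists2 c : R, 0 < c &
  (\int[lebesgue_tuple R n]_(y in eball x r) (enorm y)%:E <= (c * b)%:E)%E /\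
  (\int[lebesgue_tuple R n]_(y in eball x r) ((enorm y)^-1)%:E <=
    (4 * n%:R * (3 * n%:R) ^+ n / c * b)%:E)%E.
Proof.
move=> n1 r0 Bb lb; set mu := lebesgue_tuple R n; set B := eball x r.
have mB : measurable B := measurable_eball R n x r.
have n1R : 1 < n%:R :> R by rewrite ltr1n.
have n0 : 0 < n%:R :> R by rewrite (lt_trans ltr01).
have e0 (y : n.-tuple R) : 0 <= enorm y by exact: sqrtr_ge0.
have me : measurable_fun B (@enorm R n).
  by apply: measurable_funTS; exact: measurable_enorm.
have mev : measurable_fun B (fun y : n.-tuple R => (enorm y)^-1).
  exact: measurable_funVr.
have b0 : 0 <= b.
  by apply: le_trans lb; rewrite exprn_ge0// mulr_ge0// divr_ge0// ltW.
have xy (y : n.-tuple R) i : B y -> `|tnth x i - tnth y i| <= r.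
  by move=> /eball_sub_cube /(_ i).
have ordn0 : 'I_n by exact: (Ordinal (ltnW n1)).
pose i0 := [arg max_(i > ordn0) `|tnth x i|]%O.
have xmax i : `|tnth x i| <= `|tnth x i0|.
  by rewrite /i0; case: arg_maxP => // j _ /(_ i isT).
set L := `|tnth x i0| in xmax.
have [rL|Lr] := leP (2 * r) L.
  (* On the ball every |y_i| is at most L + r <= 3 L / 2. *)
  exists (n%:R * (3 / 2 * L)); first by rewrite !mulr_gt0//; lra.
  split.
    apply: integral_le_cst => // y By; apply: sqrt_sum_le; first lra.
    move=> i; have := xy _ i By; have := xmax i.
    rewrite ler_distlC => H1 /andP[H2 H3]; move: H1.
    by rewrite !ler_norml => /andP[H4 H5]; apply/andP; split; lra.
  (* The coordinate [i0] satisfies |y_i0| >= L - r >= L / 2. *)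
  apply: (@le_trans _ _ ((2 / L) * b)%:E).
    apply: integral_le_cst => // [y|y By]; first by rewrite invr_ge0.
    rewrite -invf_div lef_pV2 ?posrE; last 2 first.
    - apply: lt_le_trans (le_sqrt_sum _ _ (fun i => tnth y i) i0).
      have := ler_distD (tnth y i0) (tnth x i0) 0; rewrite !subr0 -/L.
      have := xy _ i0 By; lra.
    - lra.
    apply: le_trans (le_sqrt_sum _ _ (fun i => tnth y i) i0).
    have := ler_distD (tnth y i0) (tnth x i0) 0; rewrite !subr0 -/L.
    have := xy _ i0 By; lra.
  rewrite lee_fin ler_wpM2r//.
  rewrite [leRHS](_ : _ = (2 / L) * (4 / 3 * (3 * n%:R) ^+ n)); last first.
    by field; rewrite !gt_eqF//; lra.
  rewrite ler_peMr//; first by rewrite divr_ge0//; lra.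
  have : 1 <= (3 * n%:R) ^+ n :> R by rewrite exprn_ege1//; lra.
  lra.
have Bcube : B `<=` cube (origin R n) (3 * r).
  move=> y By i; rewrite tnth_mktuple sub0r normrN.
  have := ler_distD (tnth x i) (tnth y i) 0; rewrite !subr0 distrC.
  have := xy _ i By; have := xmax i; lra.
(* Bounds |y| on the cube of half-side 3 r by [sqrt_sum_le]. *)
exists (n%:R * (3 * r)); first by rewrite !mulr_gt0.
split.
  apply: integral_le_cst => // y By; apply: sqrt_sum_le; first by lra.
  by move=> i; have := Bcube _ By i; rewrite tnth_mktuple sub0r normrN.
have r30 : 0 < 3 * r by lra.
apply: (@le_trans _ _ (4 / (3 * r) * (2 * (3 * r)) ^+ n)%:E).
  apply: le_trans (integral_enorm_inv_cube R n (3 * r) n1 r30).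
  apply: ge0_subset_integral => //.
  - exact: measurable_cube.
  - apply/measurable_EFinP/measurable_funVr => //.
    by apply: measurable_funTS; exact: measurable_enorm.
  - by move=> y _; rewrite lee_fin invr_ge0.
(* The big cube has 3 n times the side of the inscribed cube, so its volume is at most (3 n)^n b. *)
rewrite lee_fin (_ : 2 * (3 * r) = (3 * n%:R) * (2 * (r / n%:R))); last first.
  by field; rewrite gt_eqF.
rewrite exprMn [leRHS](_ : _ = 4 / (3 * r) * ((3 * n%:R) ^+ n * b)); last first.
  by field; rewrite !gt_eqF.
by rewrite !ler_wpM2l// ?exprn_ge0// ?divr_ge0//; lra.
Qed.

(** * The seminorm of the power weight *)

(** The bound is uniform in centre and radius, hence passes to the supremum for every [R0]. *)
Lemma bmo_osc_power_weight (R : realType) (n : nat) (x : n.-tuple R)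
    (r a : R) :
  (1 < n)%N -> 0 < r -> `|a| <= 1 ->
  (bmo_osc (power_weight a) (power_weight a) (eball x r) <=
    (4 * n%:R * (3 * n%:R) ^+ n * `|a|)%:E)%E.
Proof.
move=> n1 r0 a1; have [b Bb lb] := lebesgue_eball R n x r n1 r0.
have [c c0 [H1 H2]] := enorm_A2 R n x r b n1 r0 Bb lb.
have b0 : 0 < b.
  apply: lt_le_trans lb; rewrite exprn_gt0// mulr_gt0// divr_gt0//.
  by rewrite ltr0n ltnW.
rewrite /bmo_osc /avg Bb/=.
apply: (power_osc_le _ _ _ (lebesgue_tuple R n) _ (@enorm R n) _ b c) => //.
- exact: measurable_eball.
- exact: measurable_enorm.
- by move=> y; exact: sqrtr_ge0.
- by apply: lebesgue_enorm_eq0; exact: ltnW.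
Qed.

Theorem lemma2p11 (R : realType) (n : nat) (hn : (1 < n)%N) :
  exists C : R, forall alpha : R, `|alpha| <= 1 ->
    forall R0 : R, 0 < R0 ->
      let mu := @power_weight R n alpha in
      let A := fun x : n.-tuple R => mu x *: (1%:M : 'M[R]_n) in
      (bmo_sq_mx R0 (eball (origin R n) 1) mu A <= (C * `|alpha|)%:E)%E.
Proof.
pose K : R := 4 * n%:R * (3 * n%:R) ^+ n.
(* One factor K for each of the n^2 entries. *)
exists ((n * n)%:R * K) => a a1 R0 _ /=.
set mu := @power_weight R n a; set A := (X in bmo_sq_mx _ _ _ X).
have K0 : 0 <= K by rewrite /K !mulr_ge0// exprn_ge0// mulr_ge0.
have entry i j : (bmo_sq R0 (eball (origin R n) 1) mu (fun x => A x i j) <=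
    (K * `|a|)%:E)%E.
  apply: ge_ereal_sup => _ [x [r [_ /andP[r0 _] ->]]].
  have [->|ij] := eqVneq i j.
    rewrite (_ : (fun x => A x j j) = mu); first exact: bmo_osc_power_weight.
    by apply/funext => y; rewrite /A !mxE eqxx mulr1.
  (* Off-diagonal entries vanish, and so does their oscillation. *)
  rewrite (_ : (fun x => A x i j) = fun=> 0); last first.
    by apply/funext => y; rewrite /A !mxE (negbTE ij) mulr0.
  rewrite /bmo_osc /avg /Rintegral integral0/= mulr0.
  under eq_integral do rewrite subr0 normr0 expr0n/= mul0r.
  by rewrite integral0 mule0 lee_fin mulr_ge0.
rewrite /bmo_sq_mx.
apply: (@le_trans _ _ (\sum_(i < n) \sum_(j < n) (K * `|a|)%:E)%E).
  by apply: lee_sum => i _; apply: lee_sum.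
under eq_bigr do rewrite sumEFin.
by rewrite sumEFin lee_fin !sumr_const !card_ord -mulrnA -mulrA mulr_natl.
Qed.
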